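(* Let $a, b, n$ be positive integers with $n\le a$ and $n\le b$, and let $\preceq_{sd}$ be the strong dominance partial ordering of $[a]\times [b]$. Let $S\subseteq [a]\times [b]$ be a set containing no chain (with respect to $\preceq_{sd}$) of length greater than $n$. Then $|S| \le n(a+b -n)$.
   Context: $[k]=\{1,\dots,k\}$. For $S\subseteq\mathbb R^d$, the strong dominance partial order $\preceq_{sd}$ on $S$ is defined by $u\preceq_{sd} v$ iff $u=v$ or every coordinate of $v$ is strictly greater than the corresponding coordinate of $u$. The length of a chain is its number of elements. *)

(* Defs.v *)
From mathcomp Require Import all_boot.

Set Implicit Arguments.
Unset Strict Implicit.
Unset Printing Implicit Defensive.

(* The grid [a] x [b] is the type 'I_a * 'I_b: the ordinal i : 'I_k, of value
   0 <= i < k, stands for the element i + 1 of [k] = {1, ..., k}.  The shift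
   preserves and reflects the strict order on coordinates. *)

Definition strong_dominance (a b : nat) : rel ('I_a * 'I_b) :=
  fun u v => (u == v) || ((u.1 < v.1) && (u.2 < v.2)).

Lemma strong_dominance_refl (a b : nat) : reflexive (@strong_dominance a b).
Proof. by move=> u; rewrite /strong_dominance eqxx. Qed.

Lemma strong_dominance_anti (a b : nat) :
  antisymmetric (@strong_dominance a b).
Proof.
move=> u v /andP[/orP[/eqP-> //|/andP[uv _]] /orP[/eqP-> //|/andP[vu _]]].
by have := ltn_trans uv vu; rewrite ltnn.
Qed.

Lemma strong_dominance_trans (a b : nat) : transitive (@strong_dominance a b).
Proof.
move=> v u w /orP[/eqP-> //|/andP[uv1 uv2]].
move=> /orP[/eqP<-|/andP[vw1 vw2]].
  by rewrite /strong_dominance uv1 uv2 orbT.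
by rewrite /strong_dominance (ltn_trans uv1 vw1) (ltn_trans uv2 vw2) orbT.
Qed.

(* The length of a chain C is its number of elements #|C|. *)
Definition is_chain (T : finType) (r : rel T) (C : {set T}) : Prop :=
  {in C &, forall u v, r u v || r v u}.

(* Main.v *)
(** Each diagonal [v - u = const] of the grid is a chain, so it carries at most
    [n] points of [S].  The hook of points having a coordinate among the [n]
    smallest has [a b - (a - n) (b - n) = n (a + b - n)] elements, and it meets
    each diagonal either in the whole diagonal or in at least [n] points.  So
    [S] has at most as many points as the hook on every diagonal. *)
Require Import Defs.
From mathcomp Require Import all_boot.
From mathcomp Require Import zify.

Lemma leq_card_fibers (T J : finType) (f : T -> J) (A B : {set T}) :
  (forall k, #|[set u in A | f u == k]| <= #|[set u in B | f u == k]|) ->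
  #|A| <= #|B|.
Proof.
move=> leAB; rewrite -!sum1_card !(partition_big f predT) //=.
by apply: leq_sum => k _; have := leAB k; rewrite -!sum1dep_card.
Qed.

(* The shift by [b] keeps the difference of coordinates nonnegative. *)
Definition diagonal (a b : nat) (u : 'I_a * 'I_b) : 'I_(a + b).+1 :=
  inord (u.1 + b - u.2).

Lemma diagonalE (a b : nat) (u v : 'I_a * 'I_b) :
  (diagonal a b u == diagonal a b v) = (u.1 + v.2 == v.1 + u.2).
Proof.
case: u v => [i j] [k l]; rewrite /diagonal -val_eqE /=.
have := ltn_ord i; have := ltn_ord j; have := ltn_ord k; have := ltn_ord l.
(* Since [u.1 < a] and [u.2 < b], the subtraction is never truncated and [inord] never takes its
   default value. *)
by move=> *; rewrite !inordK; lia.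
Qed.

Lemma is_chain_diagonal (a b : nat) (C : {set 'I_a * 'I_b}) :
  {in C &, forall u v, diagonal a b u = diagonal a b v} ->
  is_chain (@strong_dominance a b) C.
Proof.
move=> diagC [i j] [k l] uC vC; have /eqP := diagC _ _ uC vC.
rewrite diagonalE /strong_dominance !xpair_eqE -!val_eqE /=; lia.
Qed.

Definition hook (a b n : nat) : {set 'I_a * 'I_b} :=
  [set u : 'I_a * 'I_b | (u.1 < n) || (u.2 < n)].

Lemma card_geq_ord (a n : nat) : #|[set i : 'I_a | n <= i]| = a - n.
Proof.
rewrite -sum1dep_card -(big_mkord (fun i => n <= i) (fun=> 1)).
elim: a => [|a IH]; first by rewrite big_geq.
by rewrite big_mkcond big_nat_recr //= -big_mkcond /= IH; case: leqP; lia.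
Qed.

Lemma card_hook (a b n : nat) (hna : n <= a) (hnb : n <= b) :
  #|hook a b n| = n * (a + b - n).
Proof.
have hookC : ~: hook a b n =
    setX [set i : 'I_a | n <= i] [set j : 'I_b | n <= j].
  by apply/setP => -[i j]; rewrite !inE negb_or -!leqNgt.
have := cardsC (hook a b n).
by rewrite hookC cardsX !card_geq_ord card_prod !card_ord; nia.
Qed.

(** Sliding [u] down its diagonal by [m], its smaller coordinate, reaches the border of the grid.
    The [n] points of the diagonal starting there have [t < n] as one coordinate, hence lie in the
    hook. *)
Lemma leq_card_hook_diagonal (a b n : nat) (u : 'I_a * 'I_b) :
  n <= u.1 -> n <= u.2 ->
  n <= #|[set v in hook a b n | diagonal a b v == diagonal a b u]|.
Proof.
case: u => [i j] /= ni nj; set m := minn i j.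
pose f (t : 'I_n) : 'I_a * 'I_b :=
  (insubd i (i - m + t), insubd j (j - m + t)).
have f1 t : (f t).1 = i - m + t :> nat.
  by rewrite val_insubd; have := ltn_ord i; have := ltn_ord t; case: ifP; lia.
have f2 t : (f t).2 = j - m + t :> nat.
  by rewrite val_insubd; have := ltn_ord j; have := ltn_ord t; case: ifP; lia.
have injf : injective f.
  by move=> s t fst; apply: val_inj => /=; have := f1 s; rewrite fst f1; lia.
rewrite -{1}(card_ord n) -cardsT -(card_imset _ injf); apply: subset_leq_card.
apply/subsetP => _ /imsetP[t _ ->].
by rewrite !inE diagonalE f1 f2 /=; have := ltn_ord t; lia.
Qed.

Theorem theorem9 (a b n : nat) (ha : 0 < a) (hb : 0 < b) (hn : 0 < n)
    (hna : n <= a) (hnb : n <= b) (S : {set 'I_a * 'I_b})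
    (hS : forall C : {set 'I_a * 'I_b},
        C \subset S -> is_chain (@strong_dominance a b) C -> #|C| <= n) :
  #|S| <= n * (a + b - n).
Proof.
rewrite -card_hook //; apply: (leq_card_fibers _ _ (diagonal a b)) => k.
(* Either diagonal [k] has a point [u] outside the hook, and [n] separates the two counts, or it
   lies inside the hook, and inclusion suffices. *)
have [/existsP[u /andP[/eqP <- /andP[nu1 nu2]]]|nout] :=
    boolP [exists u, (diagonal a b u == k) && ((n <= u.1) && (n <= u.2))].
  apply: leq_trans (leq_card_hook_diagonal a b n u nu1 nu2).
  apply: hS; first by apply/subsetP => v; rewrite inE => /andP[].
  apply: is_chain_diagonal => v w.
  by rewrite !inE => /andP[_ /eqP->] /andP[_ /eqP->].
apply: subset_leq_card; apply/subsetP => v; rewrite !inE => /andP[_ vk].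
rewrite vk andbT; apply: contraR nout; rewrite negb_or -!leqNgt => nv.
by apply/existsP; exists v; rewrite vk.
Qed.
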